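(* Let $n\ge 3$, let $q_1,\dots,q_n\in\mathbb{H}$ with $q_1\neq 0$, and let $f_r(z)=z^n+z^{n-1}q_n+\cdots+zq_2+q_1$ be a monic quaternionic polynomial. Put $q_0=0$ and $$\alpha=\sqrt{\sum_{j=1}^{n}|q_j-q_{j-1}|^2}.$$ Then every zero $z\in\mathbb{H}$ of $f_r$ satisfies $$|z|\le \alpha+\sqrt{1+\sum_{j=1}^{n-1}|q_j|^2}.$$
   Context: $\mathbb{H}$ is the real quaternion division algebra, and $|a+bi+cj+dk|=\sqrt{a^2+b^2+c^2+d^2}$. The polynomial $f_r$ has its coefficients written on the right of the powers of $z$; a zero of $f_r$ is a quaternion $z$ with $z^n+z^{n-1}q_n+\cdots+zq_2+q_1=0$ (direct evaluation in $\mathbb{H}$). *)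

(* Defs.v *)
From HB Require Import structures.
From mathcomp Require Import all_boot all_order all_algebra.
From mathcomp Require Import ring.
From mathcomp Require Import reals.

Set Implicit Arguments.
Unset Strict Implicit.
Unset Printing Implicit Defensive.

Import Order.TTheory GRing.Theory Num.Theory.
Local Open Scope ring_scope.

(* [Quat a b c d] stands for a + b i + c j + d k. *)
Record quat (R : Type) := Quat { qre : R; qi : R; qj : R; qk : R }.

Section QuatChoice.
Variable R : Type.
Definition quat_to_tuple (x : quat R) := (qre x, qi x, qj x, qk x).
Definition tuple_to_quat (t : R * R * R * R) :=
  let: (a, b, c, d) := t in Quat a b c d.
Lemma quat_to_tupleK : cancel quat_to_tuple tuple_to_quat.
Proof. by case. Qed.
End QuatChoice.

HB.instance Definition _ (R : eqType) :=
  Equality.copy (quat R) (can_type (@quat_to_tupleK R)).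
HB.instance Definition _ (R : choiceType) :=
  Choice.copy (quat R) (can_type (@quat_to_tupleK R)).

Section QuatRing.
Variable R : comNzRingType.
Implicit Types x y z : quat R.

Definition addq x y :=
  Quat (qre x + qre y) (qi x + qi y) (qj x + qj y) (qk x + qk y).
Definition oppq x := Quat (- qre x) (- qi x) (- qj x) (- qk x).
Definition zeroq : quat R := Quat 0 0 0 0.
Definition oneq : quat R := Quat 1 0 0 0.

(* Determined by i^2 = j^2 = k^2 = ijk = -1. *)
Definition mulq x y :=
  Quat (qre x * qre y - qi x * qi y - qj x * qj y - qk x * qk y)
       (qre x * qi y + qi x * qre y + qj x * qk y - qk x * qj y)
       (qre x * qj y - qi x * qk y + qj x * qre y + qk x * qi y)
       (qre x * qk y + qi x * qj y - qj x * qi y + qk x * qre y).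

Lemma addqA : associative addq.
Proof. by move=> x y z; congr Quat; rewrite /= addrA. Qed.
Lemma addqC : commutative addq.
Proof. by move=> x y; congr Quat; rewrite /= addrC. Qed.
Lemma add0q : left_id zeroq addq.
Proof. by case=> a b c d; congr Quat; rewrite /= add0r. Qed.
Lemma addNq : left_inverse zeroq oppq addq.
Proof. by move=> x; congr Quat; rewrite /= addNr. Qed.

HB.instance Definition _ :=
  GRing.isZmodule.Build (quat R) addqA addqC add0q addNq.

Lemma mulqA : associative mulq.
Proof. by move=> x y z; congr Quat => /=; ring. Qed.
Lemma mul1q : left_id oneq mulq.
Proof. by case=> a b c d; congr Quat => /=; ring. Qed.
Lemma mulq1 : right_id oneq mulq.
Proof. by case=> a b c d; congr Quat => /=; ring. Qed.
Lemma mulqDl : left_distributive mulq addq.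
Proof. by move=> x y z; congr Quat => /=; ring. Qed.
Lemma mulqDr : right_distributive mulq addq.
Proof. by move=> x y z; congr Quat => /=; ring. Qed.
Lemma oneq_neq0 : oneq != 0 :> quat R.
Proof. by apply/eqP => -[] /eqP; rewrite oner_eq0. Qed.

HB.instance Definition _ := GRing.Zmodule_isNzRing.Build (quat R)
  mulqA mul1q mulq1 mulqDl mulqDr oneq_neq0.

End QuatRing.

Definition qnorm (R : rcfType) (x : quat R) : R :=
  Num.sqrt (qre x ^+ 2 + qi x ^+ 2 + qj x ^+ 2 + qk x ^+ 2).

(* The value at z of z^n + z^(n-1) q_n + ... + z q_2 + q_1.  The library's
   [p.[z]] puts the coefficients on the left, which differs over a
   noncommutative ring. *)
Definition f_r (H : nzRingType) (n : nat) (q : nat -> H) (z : H) : H :=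
  z ^+ n + \sum_(1 <= j < n.+1) z ^+ j.-1 * q j.

(* Main.v *)
Require Import Defs.
From HB Require Import structures.
From mathcomp Require Import all_boot all_order all_algebra.
From mathcomp Require Import ring lra.
From mathcomp Require Import reals.

Set Implicit Arguments.
Unset Strict Implicit.
Unset Printing Implicit Defensive.

Import Order.TTheory GRing.Theory Num.Theory.
Local Open Scope ring_scope.

(** The bound comes from splitting the companion matrix of [f_r].  Let
    [v = (1, z, ..., z^(n-1))], [r = |z|], and let [|v|] be the Euclidean norm.
    If [z] is a zero, then [z v = (z, ..., z^(n-1), z^n)], and its last entry is
    [z^n = - \sum_(1 <= j <= n) z^(j-1) q_j].  Writing
    [q_j = (q_j - q_(j-1)) + q_(j-1)] and using [q_0 = 0] gives
    [z^n = - \sum_(1 <= j <= n) z^(j-1) (q_j - q_(j-1))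
           - \sum_(1 <= j < n) z^j q_j].
    By Cauchy-Schwarz the first sum has norm at most [alpha |v|].  The second
    one involves only [z, ..., z^(n-1)], so it has norm at most [t k], where
    [t^2 = \sum_(1 <= j < n) r^(2j)] and [k^2 = \sum_(1 <= j < n) |q_j|^2].
    Hence
    [r^2 |v|^2 = t^2 + |z^n|^2 <= t^2 + (alpha |v| + t k)^2],
    and since [t <= |v|] and [k <= sqrt (1 + k^2)], expanding the square shows
    that the right-hand side is at most [|v|^2 (alpha + sqrt (1 + k^2))^2].
    Cancelling [|v| > 0] gives the result.

    Two facts on quaternions are used: the norm is multiplicative
    ([qnormM]) and subadditive ([ler_qnormD]). *)

Section QuatNorm.
Variable R : rcfType.
Implicit Types x y : quat R.

Lemma qnorm_ge0 x : 0 <= qnorm x.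
Proof. exact: sqrtr_ge0. Qed.

Lemma sqr_qnorm x :
  qnorm x ^+ 2 = qre x ^+ 2 + qi x ^+ 2 + qj x ^+ 2 + qk x ^+ 2.
Proof. by rewrite sqr_sqrtr // !addr_ge0 ?sqr_ge0. Qed.

Lemma qnorm0 : qnorm (0 : quat R) = 0.
Proof. by rewrite /qnorm /= expr0n /= !addr0 sqrtr0. Qed.

Lemma qnorm1 : qnorm (1 : quat R) = 1.
Proof. by rewrite /qnorm /= expr0n expr1n /= !addr0 sqrtr1. Qed.

Lemma qnormN x : qnorm (- x) = qnorm x.
Proof. by rewrite /qnorm /= !sqrrN. Qed.

(** Euler's four-square identity. *)
Lemma qnormM x y : qnorm (x * y) = qnorm x * qnorm y.
Proof.
rewrite /qnorm -sqrtrM ?addr_ge0 ?sqr_ge0 //; congr Num.sqrt => /=; ring.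
Qed.

Lemma qre_le_qnorm x : qre x <= qnorm x.
Proof.
apply: le_trans (ler_norm _) _; rewrite -sqrtr_sqr ler_wsqrtr // -!addrA lerDl.
by rewrite !addr_ge0 ?sqr_ge0.
Qed.

Definition conjq x := Quat (qre x) (- qi x) (- qj x) (- qk x).

Lemma qnorm_conj x : qnorm (conjq x) = qnorm x.
Proof. by rewrite /qnorm /= !sqrrN. Qed.

(** The Euclidean inner product of [x] and [y] is the real part of
    [x * conjq y], so multiplicativity of the norm yields the Cauchy-Schwarz
    inequality behind the triangle inequality. *)
Lemma ler_qnormD x y : qnorm (x + y) <= qnorm x + qnorm y.
Proof.
have xy_ge0 : 0 <= qnorm x + qnorm y by rewrite addr_ge0 ?qnorm_ge0.
rewrite -ler_sqr ?nnegrE ?qnorm_ge0 // sqrrD.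
have := qre_le_qnorm (x * conjq y); rewrite qnormM qnorm_conj !sqr_qnorm /=.
lra.
Qed.

End QuatNorm.

Section CauchySchwarz.
Variable R : rcfType.

Lemma cauchy_schwarz_pair (a b x y : R) :
  a * b + x * y <= Num.sqrt (a ^+ 2 + x ^+ 2) * Num.sqrt (b ^+ 2 + y ^+ 2).
Proof.
rewrite -sqrtrM ?addr_ge0 ?sqr_ge0 //.
apply: le_trans (ler_norm _) _; rewrite -sqrtr_sqr ler_wsqrtr //.
have := sqr_ge0 (a * y - x * b); lra.
Qed.

Lemma cauchy_schwarz_sum (I : Type) (s : seq I) (a b : I -> R) :
  \sum_(i <- s) a i * b i <=
  Num.sqrt (\sum_(i <- s) a i ^+ 2) * Num.sqrt (\sum_(i <- s) b i ^+ 2).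
Proof.
elim: s => [|i s IHs]; first by rewrite !big_nil sqrtr0 mulr0.
rewrite !big_cons.
have sq_ge0 (c : I -> R) : 0 <= \sum_(j <- s) c j ^+ 2.
  by apply: sumr_ge0 => j _; rewrite sqr_ge0.
have := cauchy_schwarz_pair (a i) (b i)
  (Num.sqrt (\sum_(j <- s) a j ^+ 2)) (Num.sqrt (\sum_(j <- s) b j ^+ 2)).
rewrite !sqr_sqrtr //; apply: le_trans.
by rewrite lerD2l.
Qed.

Lemma qnorm_sum_mul (I : Type) (s : seq I) (a b : I -> quat R) :
  qnorm (\sum_(i <- s) a i * b i) <=
  Num.sqrt (\sum_(i <- s) qnorm (a i) ^+ 2) *
  Num.sqrt (\sum_(i <- s) qnorm (b i) ^+ 2).
Proof.
apply: le_trans (cauchy_schwarz_sum _ _ _).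
elim: s => [|i s IHs]; first by rewrite !big_nil qnorm0.
rewrite !big_cons; apply: le_trans (ler_qnormD _ _) _.
by rewrite qnormM lerD2l.
Qed.

End CauchySchwarz.

(** Summation by parts turns the coefficients into their differences; the
    remaining sum starts at [z] because [q 0 = 0], and stops at [z ^+ n.-1],
    so that it pairs with the powers of [z] below [z ^+ n]. *)
Lemma f_r_zero_differences (H : nzRingType) (n : nat) (q : nat -> H) (z : H) :
    (0 < n)%N -> q 0%N = 0 -> f_r n q z = 0 ->
  z ^+ n = - (\sum_(1 <= j < n.+1) z ^+ j.-1 * (q j - q j.-1)
              + \sum_(1 <= j < n) z ^+ j * q j).
Proof.
move=> n_gt0 q0 /eqP; rewrite /f_r addr_eq0 => /eqP ->; congr (- _).
have -> : \sum_(1 <= j < n) z ^+ j * q j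
        = \sum_(1 <= j < n.+1) z ^+ j.-1 * q j.-1.
  by rewrite [RHS]big_add1 /= [RHS]big_ltn //= q0 mulr0 add0r.
by rewrite -big_split /=; apply: eq_bigr => j _; rewrite -mulrDr subrK.
Qed.

(** [s], [t] and [y] are the norms of [(1, z, ..., z^(n-1))],
    [(z, ..., z^(n-1))] and [z^n]; the equation on [r] says that multiplying
    the first vector by [z] multiplies its norm by [r]. *)
Lemma ratio_bound (R : realDomainType) (r s t y alpha k b : R) :
    0 < s -> 0 <= t -> 0 <= y -> 0 <= alpha -> 0 <= k -> 0 <= b ->
    s ^+ 2 = 1 + t ^+ 2 -> b ^+ 2 = 1 + k ^+ 2 ->
    (r * s) ^+ 2 = t ^+ 2 + y ^+ 2 -> y <= alpha * s + t * k ->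
  r <= alpha + b.
Proof.
move=> s_gt0 t_ge0 y_ge0 alpha_ge0 k_ge0 b_ge0 s2 b2 rs2 y_le.
have s_ge0 := ltW s_gt0.
have t_le_s : t <= s by rewrite -ler_sqr ?nnegrE // s2 lerDr ler01.
have k_le_b : k <= b by rewrite -ler_sqr ?nnegrE // b2 lerDr ler01.
rewrite -(ler_pM2r s_gt0); apply: le_trans (ler_norm _) _.
rewrite -ler_sqr ?nnegrE ?mulr_ge0 ?addr_ge0 // real_normK ?num_real // rs2.
have y2_le : y ^+ 2 <= (alpha * s + t * k) ^+ 2.
  by rewrite ler_sqr ?nnegrE // addr_ge0 ?mulr_ge0.
(* After expansion, the right-hand side [t^2 + (alpha s + t k)^2] is compared
   with [s^2 (alpha + b)^2]: the mixed term is bounded by [cross], and [t^2]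
   joins [t^2 k^2] to make [t^2 b^2], bounded by [diag]. *)
have cross : alpha * s * (t * k) <= alpha * s * (b * s).
  by rewrite ler_wpM2l ?mulr_ge0 // mulrC ler_pM.
have diag : t ^+ 2 * b ^+ 2 <= s ^+ 2 * b ^+ 2.
  by rewrite ler_wpM2r ?sqr_ge0 // ler_sqr ?nnegrE.
have diagE : t ^+ 2 * b ^+ 2 = t ^+ 2 + t ^+ 2 * k ^+ 2.
  by rewrite b2 mulrDr mulr1.
lra.
Qed.

Theorem theorem1 (R : realType) (n : nat) (hn : (3 <= n)%N)
    (q : nat -> quat R) (hq0 : q 0%N = 0) (hq1 : q 1%N != 0)
    (z : quat R) (hz : f_r n q z = 0) :
  let alpha := Num.sqrt (\sum_(1 <= j < n.+1) qnorm (q j - q j.-1) ^+ 2) in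
  qnorm z <= alpha + Num.sqrt (1 + \sum_(1 <= j < n) qnorm (q j) ^+ 2).
Proof.
cbv zeta; set alpha := (X in _ <= X + _).
have n_gt0 : (0 < n)%N by exact: leq_trans hn.
have sum_sq_ge0 (m1 m2 : nat) (F : nat -> R) :
  0 <= \sum_(m1 <= j < m2) F j ^+ 2.
  by apply: sumr_ge0 => j _; rewrite sqr_ge0.
pose S := \sum_(1 <= j < n.+1) qnorm (z ^+ j.-1) ^+ 2.
pose T := \sum_(1 <= j < n) qnorm (z ^+ j) ^+ 2.
pose Q := \sum_(1 <= j < n) qnorm (q j) ^+ 2.
have T_ge0 : 0 <= T by exact: sum_sq_ge0.
have Q_ge0 : 0 <= Q by exact: sum_sq_ge0.
have S_eq : S = 1 + T.
  by rewrite /S big_add1 /= big_ltn //= expr0 qnorm1 expr1n.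
have zS_eq : qnorm z ^+ 2 * S = T + qnorm (z ^+ n) ^+ 2.
  rewrite -[RHS](@big_nat_recr _ _ _ _ _ (fun j => qnorm (z ^+ j) ^+ 2)) //=.
  rewrite mulr_sumr; apply: eq_big_nat => -[|j] //= _.
  by rewrite -exprMn -qnormM -exprS.
have zn_le : qnorm (z ^+ n) <= alpha * Num.sqrt S + Num.sqrt T * Num.sqrt Q.
  rewrite (f_r_zero_differences n_gt0 hq0 hz) qnormN.
  apply: le_trans (ler_qnormD _ _) _; apply: lerD; last exact: qnorm_sum_mul.
  by rewrite mulrC; exact: qnorm_sum_mul.
apply: (@ratio_bound _ _ (Num.sqrt S) (Num.sqrt T) (qnorm (z ^+ n)) _
  (Num.sqrt Q)); rewrite ?sqrtr_ge0 ?qnorm_ge0 //.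
- by rewrite sqrtr_gt0 S_eq ltr_pwDl.
- by rewrite S_eq !sqr_sqrtr // addr_ge0.
- by rewrite !sqr_sqrtr // addr_ge0.
- by rewrite exprMn (sqr_sqrtr T_ge0) (@sqr_sqrtr _ S) // S_eq addr_ge0.
Qed.
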